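(* Let $(\{(G^\sigma, d^\sigma)\}_{\sigma \in \Sigma}, \{\alpha^{\sigma}_{\tau} \colon G^\tau\to G^\sigma\}_{\sigma \leqslant \tau})$ be an inverse system, indexed by an upward directed set $\Sigma$, in the category of compact metric groups with bi-invariant metrics with non-expansive homomorphisms as arrows, and assume that $\alpha^\sigma_\tau$ is surjective for all $\sigma \leqslant \tau$. Assume that there exists a compact metric space $Z$ together with, for each $\sigma\in\Sigma$, a non-expansive surjection from $Z$ onto $G^\sigma$. Then this system has an inverse limit in this category. Furthermore, (1) the object of the inverse limit does not depend, up to isometric isomorphism, on the choice of surjective arrows for the system: if $(\{(G^\sigma, d^\sigma)\}_{\sigma \in \Sigma}, \{\beta^{\sigma}_{\tau}\}_{\sigma \leqslant \tau})$ is another inverse system in this category over the same $\Sigma$ with the same objects and with all arrows surjective, then the objects of the inverse limits of the two systems are isometrically isomorphic; (2) the arrows of the inverse limit are surjective.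
   Context: A metric group is a metrizable topological group $G$ together with a fixed left-invariant metric $d$ inducing its topology; it is a metric group with bi-invariant metric if $d$ is both left- and right-invariant. A mapping $f\colon (X,d)\to(Y,\varrho)$ is non-expansive if $\varrho(f(x),f(y))\leqslant d(x,y)$ for all $x,y\in X$. An inverse system in a category $\mathsf A$ indexed by an upward directed set $\Sigma$ is a family of objects $\{A^\sigma\}_{\sigma\in\Sigma}$ with morphisms $\{\alpha_\tau^\sigma\colon A^\tau\to A^\sigma\}_{\sigma\leqslant\tau}$ such that $\alpha_\sigma^\sigma=\mathrm{id}_{A^\sigma}$ and $\alpha_\varrho^\sigma\circ\alpha_\tau^\varrho=\alpha_\tau^\sigma$ for $\sigma\leqslant\varrho\leqslant\tau$. Its inverse limit is an object $A$ of $\mathsf A$ with morphisms $\{\alpha^\sigma\colon A\to A^\sigma\}_{\sigma\in\Sigma}$ such that $\alpha_\tau^\sigma\circ\alpha^\tau=\alpha^\sigma$ for $\sigma\leqslant\tau$, and such that for every object $A'$ and morphisms $\{\xi^\sigma\colon A'\to A^\sigma\}_{\sigma\in\Sigma}$ with $\alpha_\tau^\sigma\circ\xi^\tau=\xi^\sigma$ for $\sigma\leqslant\tau$ there is a unique morphism $\nu\colon A'\to A$ with $\alpha^\sigma\circ\nu=\xi^\sigma$ for all $\sigma\in\Sigma$. *)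

(* Defs.v *)
From HB Require Import structures.
From mathcomp Require Import all_boot all_order all_algebra.
From mathcomp Require Import all_classical all_reals all_analysis.

Set Implicit Arguments.
Unset Strict Implicit.
Unset Printing Implicit Defensive.

Import Order.TTheory GRing.Theory Num.Theory.
Local Open Scope classical_set_scope.
Local Open Scope ring_scope.

(* MathComp-Analysis, over an arbitrary [R : realType].  [groupType] is the type
   of (multiplicatively written, possibly infinite) groups; the topology of a
   [metricType] is by construction the one induced by [mdist]. *)

HB.mixin Record isMetricGroup (R : realType) G & Metric R G & Group G := {
  mulg_continuous : continuous (fun p : G * G => (p.1 * p.2)%g) ;
  invg_continuous : continuous (fun x : G => (x^-1)%g) ;
  mdist_mull : forall a x y : G, mdist (a * x)%g (a * y)%g = mdist x y
}.

#[short(type="metricGroupType")]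
HB.structure Definition MetricGroup (R : realType) :=
  { G of Metric R G & Group G & isMetricGroup R G }.

HB.mixin Record isBiInvariant (R : realType) G & MetricGroup R G := {
  mdist_mulr : forall a x y : G, mdist (x * a)%g (y * a)%g = mdist x y
}.

#[short(type="biMetricGroupType")]
HB.structure Definition BiMetricGroup (R : realType) :=
  { G of MetricGroup R G & isBiInvariant R G }.

HB.mixin Record isCompactSpace (R : realType) G & BiMetricGroup R G := {
  compact_setT : compact [set: G]
}.

#[short(type="compactBiMetricGroupType")]
HB.structure Definition CompactBiMetricGroup (R : realType) :=
  { G of BiMetricGroup R G & isCompactSpace R G }.

Definition non_expansive (R : realType) (X Y : metricType R) (f : X -> Y) :=
  forall x y, mdist (f x) (f y) <= mdist x y.

Definition surjective (X Y : Type) (f : X -> Y) := set_surj [set: X] [set: Y] f.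

(* The arrows of the category whose objects are the [compactBiMetricGroupType]s. *)
Definition is_arrow (R : realType) (G H : compactBiMetricGroupType R)
    (f : G -> H) :=
  {morph f : x y / (x * y)%g} /\ non_expansive f.

Definition isometrically_isomorphic (R : realType)
    (G H : compactBiMetricGroupType R) :=
  exists f : G -> H,
    [/\ bijective f, {morph f : x y / (x * y)%g}
      & forall x y, mdist (f x) (f y) = mdist x y].

Definition upward_directed d (Sigma : preorderType d) :=
  forall s t : Sigma, exists u : Sigma, (s <= u)%O /\ (t <= u)%O.

(* [alpha s t st : G t -> G s] is the arrow written $\alpha^s_t$; as [s <= t] is
   a boolean, it does not depend on the proof [st]. *)
Definition bonding_maps (R : realType) d (Sigma : preorderType d)
    (G : Sigma -> compactBiMetricGroupType R) :=
  forall s t : Sigma, (s <= t)%O -> G t -> G s.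

Definition is_inverse_system (R : realType) d (Sigma : preorderType d)
    (G : Sigma -> compactBiMetricGroupType R) (alpha : bonding_maps G) :=
  [/\ forall (s t : Sigma) (st : (s <= t)%O), is_arrow (alpha s t st),
      forall (s : Sigma) (ss : (s <= s)%O), alpha s s ss =1 id
    & forall (s r t : Sigma) (sr : (s <= r)%O) (rt : (r <= t)%O)
        (st : (s <= t)%O), alpha s r sr \o alpha r t rt =1 alpha s t st].

Definition is_cone (R : realType) d (Sigma : preorderType d)
    (G : Sigma -> compactBiMetricGroupType R) (alpha : bonding_maps G)
    (A : compactBiMetricGroupType R) (xi : forall s : Sigma, A -> G s) :=
  (forall s : Sigma, is_arrow (xi s)) /\
  forall (s t : Sigma) (st : (s <= t)%O), alpha s t st \o xi t =1 xi s.

Definition is_inverse_limit (R : realType) d (Sigma : preorderType d)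
    (G : Sigma -> compactBiMetricGroupType R) (alpha : bonding_maps G)
    (A : compactBiMetricGroupType R) (a : forall s : Sigma, A -> G s) :=
  is_cone alpha a /\
  forall (A' : compactBiMetricGroupType R) (xi : forall s : Sigma, A' -> G s),
    is_cone alpha xi ->
    exists! nu : A' -> A,
      is_arrow nu /\ forall s : Sigma, a s \o nu =1 xi s.

(* Main.v *)
From HB Require Import structures.
Require Import Defs.
From mathcomp Require Import all_boot all_order all_algebra.
From mathcomp Require Import all_classical all_reals all_analysis.
From mathcomp Require Import lra.

(** The inverse limit is the group $L$ of threads, that is of the compatible
    families $x = (x_s)_s$, with the supremum metric
    $d(x, y) = \sup_s d(x_s, y_s)$, which is finite because every $G^s$ is a
    non-expansive image of the bounded space $Z$ ([compact_mdist_bounded]).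
    That metric is the one that makes the universal property work for
    non-expansive maps: it is the least for which all projections are
    non-expansive.  Only two things are not formal, the compactness of $L$ and
    the surjectivity of its projections, and both come from one construction.

    Fix an ultrafilter $U$ on $\Sigma$ that contains all tails
    $\{t \mid r \leq t\}$ ([cofinal_ultrafilter]).  Any family of points
    $w_t \in G^t$, compatible or not, yields a thread
    $x_r = \lim_{t \to U} \alpha^r_t(w_t)$ ([ultralimit_thread]); the limits
    exist since each $G^r$ is compact.
    - If the $w_t$ are preimages of a given $y \in G^s$ then $x_s = y$, so that
      the projections are onto ([thread_proj_surjective]).
    - If $w_t = p_t(z)$ for non-expansive surjections $p_t : Z \to G^t$, then
      $z \mapsto x$ is a non-expansive map from $Z$ onto $L$, so that $L$ is
      compact ([thread_compact]).  It is onto because for a thread $y$ one may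
      pick $z_t$ with $p_t(z_t) = y_t$ and let $z = \lim_U z_t$.

    For the independence of the bonding maps, let $a_s : A \to G^s$ and
    $b_s : B \to G^s$ be the limit arrows of the two systems.  When $t$ is far
    in $\Sigma$, both $a_t$ and $b_t$ almost preserve distances and are onto
    the same group $G^t$, so a section $h_t$ of $b_t$ gives a map
    $h_t \circ a_t : A \to B$ that is almost an isometric isomorphism; the
    pointwise limit along $U$ of these maps is an exact one
    ([isometric_of_cones]).  All limit computations are instances of a single
    fact: a comparison between distances that holds eventually passes to the
    limit ([mdist_lim_le]). *)

Set Implicit Arguments.
Unset Strict Implicit.
Unset Printing Implicit Defensive.

Import Order.TTheory GRing.Theory Num.Theory.
Import metricType_numDomainType.
Local Open Scope classical_set_scope.
Local Open Scope ring_scope.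

Lemma choice_dep (I : Type) (T : I -> Type) (P : forall i, T i -> Prop) :
  (forall i, exists x, P i x) -> exists f : forall i, T i, forall i, P i (f i).
Proof. by move=> ex; exists (fun i => sval (cid (ex i))) => i; case: cid. Qed.

(** * Limits of points and distances along filters *)

Section MetricLimits.
Context (R : realType) (I : Type) (F : set_system I) {FF : ProperFilter F}.

(** The distance is jointly continuous, so both sides converge; constant
    families are allowed, which covers bounds by a fixed distance and, taking
    $u' = v'$, proofs that two limits coincide. *)
Lemma mdist_lim_le (X X' : metricType R) (u v : I -> X) (u' v' : I -> X')
    x y x' y' :
  u @ F --> x -> v @ F --> y -> u' @ F --> x' -> v' @ F --> y' ->
  (\forall i \near F, mdist (u i) (v i) <= mdist (u' i) (v' i)) ->
  mdist x y <= mdist x' y'.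
Proof.
move=> ux vy ux' vy' uv; apply/ler_addgt0Pl => e e0.
(* Four points are moved to their limits, each at the cost of e / 4. *)
have e4 : 0 < e / 4 by rewrite divr_gt0.
have [i [[xi yi] [xi' yi'] uvi]] : exists i, [/\
    mdist x (u i) < e / 4 /\ mdist y (v i) < e / 4,
    mdist x' (u' i) < e / 4 /\ mdist y' (v' i) < e / 4 &
    mdist (u i) (v i) <= mdist (u' i) (v' i)].
  apply: (@filter_ex _ F); near=> i.
  split=> //; last by near: i.
    by split; near: i; apply: cvgr_dist_lt.
  by split; near: i; apply: cvgr_dist_lt.
have := metric_triangle x (u i) y; have := metric_triangle (u i) (v i) y.
have := metric_triangle (u' i) x' (v' i).
have := metric_triangle x' y' (v' i).
rewrite (metric_sym (v i)) (metric_sym (u' i) x').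
lra.
Unshelve. all: by end_near. Qed.

Lemma metric_cvg_unique (X : metricType R) (u : I -> X) (x y : X) :
  u @ F --> x -> u @ F --> y -> x = y.
Proof. by move=> ux uy; apply: (cvg_unique (@metric_hausdorff _ X)) ux uy. Qed.

Lemma non_expansive_cvg (X Y : metricType R) (f : X -> Y) (u : I -> X) x :
  non_expansive f -> u @ F --> x -> f \o u @ F --> f x.
Proof.
move=> fne ux; apply/cvgrPdist_lt => e e0.
by apply: filterS (cvgr_dist_lt ux e0) => i; apply: le_lt_trans; exact: fne.
Qed.

End MetricLimits.

Lemma non_expansive_continuous (R : realType) (X Y : metricType R)
    (f : X -> Y) :
  non_expansive f -> continuous f.
Proof. by move=> fne x; exact: non_expansive_cvg. Qed.

(** The image of an ultrafilter is an ultrafilter, and these all converge in a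
    compact space. *)
Lemma compact_ultralimit (R : realType) (X : metricType R) (I : Type)
    (U : set_system I) (u : I -> X) :
  compact [set: X] -> UltraFilter U -> exists x : X, u @ U --> x.
Proof.
move=> cX UU.
have : UltraFilter (u @ U).
  split=> [|H PH sUH]; first exact: fmap_proper_filter.
  apply/seteqP; split=> // A HA.
  have [//|UnA] := in_ultra_setVsetC (u @^-1` A) UU.
  have HnA : H (~` A) by apply: sUH.
  have FH : Filter H by exact: filter_filter.
  by have /filter_ex[? []] : H (A `&` ~` A) by exact: filterI.
rewrite compact_ultra in cX.
move=> /cX; case; first exact: filterT.
by move=> x [_ ux]; exists x.
Qed.

(** The distance to a fixed point is a continuous real function, hence bounded
    on a compact space. *)
Lemma compact_mdist_bounded (R : realType) (X : metricType R) :
  compact [set: X] -> exists D : R, forall x y : X, mdist x y <= D.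
Proof.
move=> cX; have [[z _]|X0] := pselect ([set: X] !=set0); last first.
  by exists 0 => x; case: X0; exists x.
have fne : non_expansive (mdist z : X -> R^o).
  move=> x y; rewrite /mdist /= ler_norml.
  have := metric_triangle z x y; have := metric_triangle z y x.
  rewrite (metric_sym y x) /mdist/=. lra.
have /compact_bounded [M [_ HM]] :
    compact ((mdist z : X -> R^o) @` [set: X]).
  apply: continuous_compact cX.
  by apply: continuous_subspaceT; exact: non_expansive_continuous.
exists ((M + 1) + (M + 1)) => x y.
have b w : mdist z w <= M + 1.
  apply: le_trans (ler_norm _) _.
  by apply: (HM (M + 1)); [rewrite ltrDl | exists w].
apply: le_trans (metric_triangle x z y) _.
by rewrite lerD// metric_sym.
Qed.

Lemma uniform_mdist_bound (R : realType) (J : Type) (Z : metricType R)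
    (Y : J -> metricType R) :
  compact [set: Z] ->
  (forall i, exists p : Z -> Y i, non_expansive p /\ surjective p) ->
  exists D : R, forall i (x y : Y i), mdist x y <= D.
Proof.
move=> cZ onto; have [D bound] := compact_mdist_bounded cZ.
exists D => i x y; have [p [pne psurj]] := onto i.
have [z _ <-] := psurj x I; have [z' _ <-] := psurj y I.
exact: le_trans (pne _ _) (bound _ _).
Qed.

(** Directedness says exactly that the tails form a base of a proper filter. *)
Lemma cofinal_ultrafilter (d : Order.disp_t) (Sigma : preorderType d) :
  upward_directed Sigma -> [set: Sigma] !=set0 ->
  exists2 U : set_system Sigma, UltraFilter U &
    forall r, U [set t | (r <= t)%O].
Proof.
move=> dir [s0 _].
pose B r : set Sigma := [set t | (r <= t)%O].
have PF : ProperFilter (filter_from setT B).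
  apply: filter_from_proper; last by move=> r _; exists r; exact: lexx.
  apply: filter_fromT_filter; first by exists s0.
  move=> i j; have [k [ik jk]] := dir i j.
  by exists k => t /= kt; split; apply: le_trans kt.
have [U [UU sU]] := ultraFilterLemma PF.
by exists U => // r; apply: sU; exists r.
Qed.

(** * The group of threads with the supremum metric *)

(** For non-expansive $f_i$ this says that
    $d(x, y) = \sup_i d(f_i(x), f_i(y))$.  The condition $0 \leq c$ only
    matters for an empty family, where it forces $X$ to have at most one
    point. *)
Definition jointly_non_contracting (R : realType) (I : Type) (X : metricType R)
    (Y : I -> metricType R) (f : forall i, X -> Y i) :=
  forall x y c, 0 <= c -> (forall i, mdist (f i x) (f i y) <= c) ->
    mdist x y <= c.

Section Threads.
Context (R : realType) (d : Order.disp_t) (Sigma : preorderType d).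
Context (G : Sigma -> compactBiMetricGroupType R) (alpha : bonding_maps G).

Definition is_thread (x : forall s, G s) :=
  forall s t (st : (s <= t)%O), alpha st (x t) = x s.

(** The system axioms and the bound on the diameters are parameters of the type
    because its group structure depends on the former and its metric on the
    latter. *)
Definition thread (sys : is_inverse_system alpha) (D : R)
  (bound : forall s (x y : G s), mdist x y <= D) : Type :=
  {x : forall s, G s | is_thread x}.

Context (sys : is_inverse_system alpha) (D : R).
Context (bound : forall s (x y : G s), mdist x y <= D).

Local Notation L := (thread sys bound).

HB.instance Definition _ := gen_eqMixin L.
HB.instance Definition _ := gen_choiceMixin L.

Lemma thread_ext (x y : L) : (forall s, sval x s = sval y s) -> x = y.
Proof.
case: x y => [x xP] [y yP] /= xy.
have E : x = y by apply/functional_extensionality_dep.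
by case: _ / E yP => yP; congr exist; exact: Prop_irrelevance.
Qed.

Let alphaM s t (st : (s <= t)%O) : {morph alpha st : x y / (x * y)%g}.
Proof. by case: sys => /(_ s t st)[]. Qed.

Let alpha1 s t (st : (s <= t)%O) : alpha st 1%g = 1%g.
Proof. by apply: (mulgI (alpha st 1%g)); rewrite -alphaM !mulg1. Qed.

Let alphaV s t (st : (s <= t)%O) x : alpha st (x^-1)%g = ((alpha st x)^-1)%g.
Proof. by apply: (mulgI (alpha st x)); rewrite -alphaM !mulgV alpha1. Qed.

Let is_thread_one : is_thread (fun s => 1%g).
Proof. exact: alpha1. Qed.

Let is_thread_mul (x y : L) : is_thread (fun s => (sval x s * sval y s)%g).
Proof. by move=> s t st; rewrite alphaM (proj2_sig x) (proj2_sig y). Qed.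

Let is_thread_inv (x : L) : is_thread (fun s => (sval x s)^-1%g).
Proof. by move=> s t st; rewrite alphaV (proj2_sig x). Qed.

Let thread_one : L := exist _ _ is_thread_one.
Let thread_mul (x y : L) : L := exist _ _ (is_thread_mul x y).
Let thread_inv (x : L) : L := exist _ _ (is_thread_inv x).

Let thread_mulA : associative thread_mul.
Proof. by move=> x y z; apply: thread_ext => s /=; rewrite mulgA. Qed.
Let thread_mul1 : left_id thread_one thread_mul.
Proof. by move=> x; apply: thread_ext => s /=; rewrite mul1g. Qed.
Let thread_1mul : right_id thread_one thread_mul.
Proof. by move=> x; apply: thread_ext => s /=; rewrite mulg1. Qed.
Let thread_mulV : left_inverse thread_one thread_inv thread_mul.
Proof. by move=> x; apply: thread_ext => s /=; rewrite mulVg. Qed.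
Let thread_Vmul : right_inverse thread_one thread_inv thread_mul.
Proof. by move=> x; apply: thread_ext => s /=; rewrite mulgV. Qed.

HB.instance Definition _ := isGroup.Build L thread_mulA thread_mul1 thread_1mul
  thread_mulV thread_Vmul.

(* Adding 0 gives the right value for an empty index set as well. *)
Let thread_dist (x y : L) : R :=
  sup ([set 0] `|` range (fun s => mdist (sval x s) (sval y s))).

Let thread_dist_ub (x y : L) :
  has_ubound ([set 0] `|` range (fun s => mdist (sval x s) (sval y s))).
Proof.
exists `|D| => _ [->|[s _ <-]]; first exact: normr_ge0.
exact: le_trans (bound (sval x s) (sval y s)) (ler_norm _).
Qed.

Let thread_dist_ge0 (x y : L) : 0 <= thread_dist x y.
Proof. by apply: ub_le_sup; [exact: thread_dist_ub | left]. Qed.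

Let thread_dist_ge (x y : L) s : mdist (sval x s) (sval y s) <= thread_dist x y.
Proof. by apply: ub_le_sup; [exact: thread_dist_ub | right; exists s]. Qed.

Let thread_dist_le (x y : L) c : 0 <= c ->
  (forall s, mdist (sval x s) (sval y s) <= c) -> thread_dist x y <= c.
Proof.
move=> c0 xyc; apply: ge_sup; first by exists 0; left.
by move=> _ [->|[s _ <-]].
Qed.

Let thread_distxx x : thread_dist x x = 0.
Proof.
apply/eqP; rewrite eq_le thread_dist_ge0 andbT.
by apply: thread_dist_le => // s; rewrite mdistxx.
Qed.

Let thread_dist_eq0 x y : thread_dist x y = 0 -> x = y.
Proof.
move=> xy0; apply: thread_ext => s; apply: mdist_positivity.
by apply/eqP; rewrite eq_le mdist_ge0 andbT -xy0 thread_dist_ge.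
Qed.

Let thread_dist_sym (x y : L) : thread_dist x y = thread_dist y x.
Proof.
rewrite /thread_dist; do 3 f_equal.
by apply/funext => s; rewrite metric_sym.
Qed.

Let thread_dist_triangle (y x z : L) :
  thread_dist x z <= thread_dist x y + thread_dist y z.
Proof.
apply: thread_dist_le => [|s]; first by rewrite addr_ge0.
apply: le_trans (metric_triangle _ (sval y s) _) _.
by rewrite lerD ?thread_dist_ge.
Qed.

HB.instance Definition _ := isMetric.Build R L thread_distxx thread_dist_eq0
  thread_dist_sym thread_dist_triangle.

Definition thread_proj s (x : L) : G s := sval x s.

Lemma thread_proj_non_expansive s : non_expansive (@thread_proj s).
Proof. by move=> x y; exact: thread_dist_ge. Qed.

Lemma thread_proj_jointly_non_contracting : jointly_non_contracting thread_proj.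
Proof. by move=> x y c; exact: thread_dist_le. Qed.

(* Bi-invariance of the factors enters here: translating on each side separately
   makes multiplication non-expansive for the sum of the distances, and this
   yields continuity and bi-invariance at once. *)
Let mdistM (x y x' y' : L) :
  mdist (x * y)%g (x' * y')%g <= mdist x x' + mdist y y'.
Proof.
apply: thread_proj_jointly_non_contracting => [|s].
  by rewrite addr_ge0 ?mdist_ge0.
rewrite /thread_proj/=.
apply: le_trans (metric_triangle _ (sval x' s * sval y s)%g _) _.
rewrite mdist_mulr mdist_mull.
by rewrite lerD ?thread_dist_ge.
Qed.

Let mdistV (x y : L) : mdist (x^-1)%g (y^-1)%g <= mdist x y.
Proof.
apply: thread_proj_jointly_non_contracting => [|s]; first exact: mdist_ge0.
rewrite /thread_proj/= -(mdist_mull (sval x s)) -(mdist_mulr (sval y s)).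
rewrite mulgV mul1g mulgVK metric_sym.
exact: thread_dist_ge.
Qed.

Let thread_mul_continuous : continuous (fun p : L * L => (p.1 * p.2)%g).
Proof.
move=> [x y]; apply/cvgrPdist_lt => e e0.
have e2 : 0 < e / 2 by rewrite divr_gt0.
exists (ball x (e / 2), ball y (e / 2)) => /=.
  by split; exact: nbhsx_ballx.
move=> [x' y'] [/= xx' yy']; apply: le_lt_trans (mdistM _ _ _ _) _.
by rewrite [e]splitr ltrD // -[_ < _]/(ball _ _ _).
Qed.

Let thread_inv_continuous : continuous (fun x : L => (x^-1)%g).
Proof. exact: non_expansive_continuous. Qed.

Let thread_mdist_mull (a x y : L) : mdist (a * x)%g (a * y)%g = mdist x y.
Proof.
apply/eqP; rewrite eq_le; apply/andP; split.
  by have := mdistM a x a y; rewrite mdistxx add0r.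
have := mdistM (a^-1)%g (a * x)%g (a^-1)%g (a * y)%g.
by rewrite !mulKg mdistxx add0r.
Qed.

Let thread_mdist_mulr (a x y : L) : mdist (x * a)%g (y * a)%g = mdist x y.
Proof.
apply/eqP; rewrite eq_le; apply/andP; split.
  by have := mdistM x a y a; rewrite mdistxx addr0.
have := mdistM (x * a)%g (a^-1)%g (y * a)%g (a^-1)%g.
by rewrite !mulgK mdistxx addr0.
Qed.

HB.instance Definition _ := isMetricGroup.Build R L thread_mul_continuous
  thread_inv_continuous thread_mdist_mull.
HB.instance Definition _ := isBiInvariant.Build R L thread_mdist_mulr.

End Threads.

Arguments thread_proj {R d Sigma G alpha} sys {D} bound s x.

(** * Threads as limits along a cofinal ultrafilter *)

Section Ultralimits.
Context (R : realType) (d : Order.disp_t) (Sigma : preorderType d).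
Context (G : Sigma -> compactBiMetricGroupType R) (alpha : bonding_maps G).
Context (sys : is_inverse_system alpha) (D : R).
Context (bound : forall s (x y : G s), mdist x y <= D).

Local Notation L := (thread sys bound).
Local Notation proj := (thread_proj sys bound).

(** The family $t \mapsto \alpha^r_t(w_t)$, made total; only its values for
    large $t$ are ever used. *)
Definition pushdown (w : forall t, G t) (r t : Sigma) : G r :=
  if (r <= t)%O =P true is ReflectT rt then alpha rt (w t) else 1%g.

Lemma pushdownE w r t (rt : (r <= t)%O) : pushdown w r t = alpha rt (w t).
Proof.
rewrite /pushdown; case: eqP => // rt'.
by rewrite (bool_irrelevance rt' rt).
Qed.

Lemma bonding_non_expansive s t (st : (s <= t)%O) : non_expansive (alpha st).
Proof. by case: sys => /(_ s t st)[]. Qed.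

(** Compatibility of the limits: $\alpha^r_s$ is continuous and, for
    $t \geq s$, sends $\alpha^s_t(w_t)$ to $\alpha^r_t(w_t)$. *)
Lemma ultralimit_thread (U : set_system Sigma) (w : forall t, G t) :
  UltraFilter U -> (forall r, U [set t | (r <= t)%O]) ->
  exists x : L, forall r, pushdown w r @ U --> proj r x.
Proof.
move=> UU Utail.
have /choice_dep [x wx] : forall r, exists y : G r, pushdown w r @ U --> y.
  by move=> r; apply: compact_ultralimit; exact: compact_setT.
have xP : is_thread alpha x.
  move=> r s rs.
  apply/esym/(metric_cvg_unique (wx r)).
  apply: cvg_trans (non_expansive_cvg (bonding_non_expansive rs) (wx s)).
  apply: near_eq_cvg.
  apply: filterS (Utail s) => t st /=.
  have rt : (r <= t)%O by exact: le_trans rs st.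
  rewrite !pushdownE; case: sys => _ _ comp.
  by rewrite -(comp _ _ _ rs st rt).
by exists (exist _ x xP).
Qed.

Lemma thread_proj_surjective : upward_directed Sigma ->
  (forall s t (st : (s <= t)%O), surjective (alpha st)) ->
  forall s, surjective (proj s).
Proof.
move=> dir surj s y _.
have [U UU Utail] := cofinal_ultrafilter dir (ex_intro _ s I).
have /choice_dep [w wy] : forall t, exists v : G t,
    forall st : (s <= t)%O, alpha st v = y.
  move=> t; have [st|nst] := pselect (s <= t)%O; last first.
    by exists 1%g => st; case: (nst st).
  have [v _ vy] := surj s t st y I; exists v => st'.
  by rewrite (bool_irrelevance st' st).
have [x wx] := ultralimit_thread w UU Utail; exists x => //.
apply: (metric_cvg_unique (wx s)).
apply: cvg_near_cst.
by apply: filterS (Utail s) => t st; rewrite pushdownE.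
Qed.

(** An empty index set is treated apart: it carries no ultrafilter, and $Z$ may
    then be empty while there is one thread. *)
Lemma thread_compact (Z : metricType R) :
  upward_directed Sigma -> compact [set: Z] ->
  (forall s, exists p : Z -> G s, non_expansive p /\ surjective p) ->
  compact [set: L].
Proof.
move=> dir cZ /choice_dep[p pP].
have [S0|Sempty] := pselect ([set: Sigma] !=set0); last first.
  suff -> : [set: L] = [set 1%g] by exact: compact_set1.
  apply/seteqP; split=> // x _; apply: thread_ext => s.
  by case: Sempty; exists s.
have [U UU Utail] := cofinal_ultrafilter dir S0.
have pne s : non_expansive (p s) by case: (pP s).
have /choice[q qP] : forall z, exists x : L, forall r,
    pushdown (fun t => p t z) r @ U --> proj r x.
  by move=> z; exact: ultralimit_thread UU Utail.
have qne : non_expansive q.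
  move=> z z'; apply: thread_proj_jointly_non_contracting => [|r].
    exact: mdist_ge0.
  apply: (mdist_lim_le (qP z r) (qP z' r) (cvg_cst z) (cvg_cst z')).
  apply: filterS (Utail r) => t rt; rewrite !pushdownE.
  exact: le_trans (bonding_non_expansive _ _ _) (pne _ _ _).
suff -> : [set: L] = q @` [set: Z].
  apply: continuous_compact cZ.
  by apply: continuous_subspaceT; exact: non_expansive_continuous.
apply/seteqP; split=> // x _.
(* Lifting each coordinate of x to Z, the limit of the lifts is mapped to x. *)
have /choice[zeta zetaP] : forall t, exists z, p t z = proj t x.
  by move=> t; have [_ /(_ (proj t x) I)[z _ ?]] := pP t; exists z.
have [z zetaz] := compact_ultralimit zeta cZ UU.
exists z => //; apply: mdist_positivity; apply/eqP.
rewrite eq_le mdist_ge0 andbT.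
apply: thread_proj_jointly_non_contracting => // r.
rewrite -(mdistxx z).
apply: (mdist_lim_le (qP z r) (cvg_cst _) (cvg_cst z) zetaz).
apply: filterS (Utail r) => t rt; rewrite pushdownE.
have <- : alpha rt (p t (zeta t)) = proj r x.
  by rewrite zetaP; exact: (proj2_sig x).
exact: le_trans (bonding_non_expansive _ _ _) (pne _ _ _).
Qed.

End Ultralimits.

(** * Inverse limits *)

Section InverseLimits.
Context (R : realType) (d : Order.disp_t) (Sigma : preorderType d).
Context (G : Sigma -> compactBiMetricGroupType R).
Implicit Types alpha beta : bonding_maps G.

Lemma is_arrow_id (A : compactBiMetricGroupType R) : is_arrow (@id A).
Proof. by split. Qed.

Lemma is_arrow_comp (A B C : compactBiMetricGroupType R) (f : B -> C)
  (g : A -> B) : is_arrow f -> is_arrow g -> is_arrow (f \o g).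
Proof.
move=> [fM fne] [gM gne]; split=> x y /=; first by rewrite gM fM.
exact: le_trans (fne _ _) (gne _ _).
Qed.

Lemma inverse_limit_unique alpha
    (A : compactBiMetricGroupType R) (a : forall s, A -> G s)
    (B : compactBiMetricGroupType R) (b : forall s, B -> G s) :
  is_inverse_limit alpha a -> is_inverse_limit alpha b ->
  exists f : A -> B, exists g : B -> A,
    [/\ is_arrow f, is_arrow g, cancel f g, cancel g f &
      (forall s x, b s (f x) = a s x) /\ (forall s y, a s (g y) = b s y)].
Proof.
have fac (C E : compactBiMetricGroupType R) (c : forall s, C -> G s)
    (e : forall s, E -> G s) : is_inverse_limit alpha c ->
    is_inverse_limit alpha e ->
    exists f : C -> E, is_arrow f /\ forall s, e s \o f =1 c s.
  by move=> [cc _] [_ /(_ _ _ cc)[f [fP _]]]; exists f.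
have idE (C : compactBiMetricGroupType R) (c : forall s, C -> G s) (h : C -> C) :
    is_inverse_limit alpha c -> is_arrow h ->
    (forall s, c s \o h =1 c s) -> h =1 id.
  move=> [cc /(_ _ _ cc)[k [_ kU]]] ha hc x.
  by rewrite -(kU h) // (kU id) //; split; [exact: is_arrow_id|].
move=> la lb.
have [f [fa fb]] := fac _ _ _ _ la lb; have [g [ga gb]] := fac _ _ _ _ lb la.
exists f, g; split=> //.
- apply: (idE _ _ (g \o f) la); first exact: is_arrow_comp.
  by move=> s x; exact: etrans (gb s (f x)) (fb s x).
- apply: (idE _ _ (f \o g) lb); first exact: is_arrow_comp.
  by move=> s x; exact: etrans (fb s (g x)) (gb s x).
Qed.

Lemma non_expansive_cancel_isometry (X Y : metricType R)
    (f : X -> Y) (g : Y -> X) :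
  non_expansive f -> non_expansive g -> cancel f g ->
  forall x y, mdist (f x) (f y) = mdist x y.
Proof.
move=> fne gne fK x y; apply/eqP; rewrite eq_le fne /=.
by rewrite -{1}(fK x) -{1}(fK y) gne.
Qed.

Section CompactThreads.
Context alpha (sys : is_inverse_system alpha) (D : R).
Context (bound : forall s (x y : G s), mdist x y <= D).
Hypothesis compactL : compact [set: thread sys bound].

Definition compact_thread : compactBiMetricGroupType R :=
  HB.pack (thread sys bound)
    (isCompactSpace.Build R (thread sys bound) compactL).

Lemma compact_thread_inverse_limit :
  @is_inverse_limit _ _ _ _ alpha compact_thread (thread_proj sys bound).
Proof.
split.
  split=> [s|s t st x]; last exact: (proj2_sig x).
  by split=> //; exact: thread_proj_non_expansive.
move=> A' xi [xiA xiC].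
have xiT x : is_thread alpha (xi ^~ x) by move=> s t st; exact: xiC.
pose nu (x : A') : thread sys bound := exist _ _ (xiT x).
exists nu; split.
  split=> //; split.
    by move=> x y; apply: thread_ext => s /=; case: (xiA s) => ->.
  move=> x y; apply: thread_proj_jointly_non_contracting => [|s].
    exact: mdist_ge0.
  by case: (xiA s) => _; apply.
move=> nu' [_ nu'xi]; apply/funext => x; apply: thread_ext => s.
by rewrite [LHS]/= -(nu'xi s x).
Qed.

End CompactThreads.

(** The two properties of a limit that the comparison of two systems uses.  They
    hold for the threads and are invariant under isometric isomorphisms of
    cones, hence hold for every inverse limit. *)
Lemma inverse_limit_regular alpha (Z : metricType R)
    (A : compactBiMetricGroupType R) (a : forall s, A -> G s) :
  upward_directed Sigma -> is_inverse_system alpha ->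
  (forall s t (st : (s <= t)%O), surjective (alpha s t st)) ->
  compact [set: Z] ->
  (forall s, exists p : Z -> G s, non_expansive p /\ surjective p) ->
  is_inverse_limit alpha a ->
  jointly_non_contracting a /\ (forall s, surjective (a s)).
Proof.
move=> dir sys surj cZ onto la.
have [D bound] := uniform_mdist_bound cZ onto.
have cL : compact [set: thread sys bound] by exact: thread_compact dir cZ onto.
have [f [g [[_ fne] [_ gne] fK _ [proj_f a_g]]]] :=
  inverse_limit_unique la (compact_thread_inverse_limit cL).
split=> [x y c c0 axy|s y _].
  rewrite -(non_expansive_cancel_isometry fne gne fK).
  apply: thread_proj_jointly_non_contracting => // s.
  by rewrite !proj_f.
have [x _ <-] : range (thread_proj sys bound s) y.
  exact: thread_proj_surjective dir surj s y I.
by exists (g x).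
Qed.

(** With $h_t$ a section of $b_t$, the isomorphism is
    $g(x) = \lim_{t \to U} h_t(a_t(x))$.  Distances of $b_r$-images are
    dominated by those of $b_t$-images for $t \geq r$, and
    $b_t \circ h_t = \mathrm{id}$; hence, after composition with $b_r$, the maps
    $h_t \circ a_t$ are non-expansive, multiplicative and onto as far as limits
    can tell, and so is $g$ because the $b_r$ together determine the distance
    of $B$.  In the same way $g$ does not contract distances because the $a_r$
    determine that of $A$ and $h_t$ does not contract any. *)
Lemma isometric_of_cones alpha beta
    (A : compactBiMetricGroupType R) (a : forall s, A -> G s)
    (B : compactBiMetricGroupType R) (b : forall s, B -> G s) :
  upward_directed Sigma -> [set: Sigma] !=set0 ->
  is_inverse_system alpha -> is_inverse_system beta ->
  is_cone alpha a -> jointly_non_contracting a -> (forall s, surjective (a s)) ->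
  is_cone beta b -> jointly_non_contracting b -> (forall s, surjective (b s)) ->
  isometrically_isomorphic A B.
Proof.
move=> dir S0 asys bsys [aA aC] aiso asurj [bA bC] biso bsurj.
have [U UU Utail] := cofinal_ultrafilter dir S0.
have ane s : non_expansive (a s) by case: (aA s).
have bne s : non_expansive (b s) by case: (bA s).
have aM s : {morph a s : x y / (x * y)%g} by case: (aA s).
have bM s : {morph b s : x y / (x * y)%g} by case: (bA s).
have a_le r t x y : (r <= t)%O -> mdist (a r x) (a r y) <= mdist (a t x) (a t y).
  by move=> rt; rewrite -!(aC r t rt); exact: (bonding_non_expansive asys).
have b_le r t x y : (r <= t)%O -> mdist (b r x) (b r y) <= mdist (b t x) (b t y).
  by move=> rt; rewrite -!(bC r t rt); exact: (bonding_non_expansive bsys).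
have /choice_dep[sec secK] : forall t, exists h : G t -> B, cancel h (b t).
  move=> t; have /choice[h hP] : forall y, exists x, b t x = y.
    by move=> y; have [x _ ?] := bsurj t y I; exists x.
  by exists h.
have /choice[g gP] : forall x, exists y : B, (fun t => sec t (a t x)) @ U --> y.
  by move=> x; apply: compact_ultralimit UU; exact: compact_setT.
have bgP r x : (fun t => b r (sec t (a t x))) @ U --> b r (g x).
  exact: non_expansive_cvg (bne r) (gP x).
have giso x y : mdist (g x) (g y) = mdist x y.
  apply/eqP; rewrite eq_le; apply/andP; split.
    apply: biso => [|r]; first exact: mdist_ge0.
    apply: (mdist_lim_le (bgP r x) (bgP r y) (cvg_cst x) (cvg_cst y)).
    apply: filterS (Utail r) => t rt; apply: le_trans (b_le _ _ _ _ rt) _.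
    by rewrite !secK ane.
  apply: aiso => [|r]; first exact: mdist_ge0.
  apply: (mdist_lim_le (cvg_cst (a r x)) (cvg_cst (a r y)) (gP x) (gP y)).
  apply: filterS (Utail r) => t rt; apply: le_trans (a_le _ _ _ _ rt) _.
  by rewrite -{1}(secK t (a t x)) -{1}(secK t (a t y)) bne.
have gM : {morph g : x y / (x * y)%g}.
  move=> x y; apply: mdist_positivity; apply/eqP; rewrite eq_le mdist_ge0 andbT.
  apply: biso => // r; rewrite -(mdistxx (1%g : B)) bM.
  have xy : (fun t => (b r (sec t (a t x)) * b r (sec t (a t y)))%g) @ U
      --> (b r (g x) * b r (g y))%g.
    apply: continuous2_cvg (bgP r x) (bgP r y).
    exact: (@mulg_continuous _ (G r) (b r (g x), b r (g y))).
  apply: (mdist_lim_le (bgP r (x * y)%g) xy (cvg_cst 1%g) (cvg_cst 1%g)).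
  apply: filterS (Utail r) => t rt; rewrite -bM.
  apply: le_trans (b_le _ _ _ _ rt) _.
  by rewrite bM !secK aM !mdistxx.
exists g; split=> //.
rewrite -setTT_bijective; split=> //.
  move=> x y _ _ gxy; apply: mdist_positivity.
  by rewrite -giso gxy mdistxx.
move=> y _.
(* A preimage of y: the limit of points whose image under a t is b t y. *)
have /choice[xi xiP] : forall t, exists x, a t x = b t y.
  by move=> t; have [x _ ?] := asurj t (b t y) I; exists x.
have [x xix] := compact_ultralimit xi (@compact_setT _ A) UU.
exists x => //; apply: mdist_positivity; apply/eqP.
rewrite eq_le mdist_ge0 andbT; apply: biso => // r.
rewrite -(mdistxx x).
apply: (mdist_lim_le (bgP r x) (cvg_cst (b r y)) (cvg_cst x) xix).
apply: filterS (Utail r) => t rt; apply: le_trans (b_le _ _ _ _ rt) _.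
by rewrite secK -xiP ane.
Qed.

End InverseLimits.

Theorem theorem3p3 (R : realType) (d : Order.disp_t) (Sigma : preorderType d)
    (dirSigma : upward_directed Sigma)
    (G : Sigma -> compactBiMetricGroupType R)
    (alpha : bonding_maps G)
    (alpha_sys : is_inverse_system alpha)
    (alpha_surj : forall (s t : Sigma) (st : (s <= t)%O),
        surjective (alpha s t st))
    (Z : metricType R) (Z_compact : compact [set: Z])
    (Z_onto : forall s : Sigma,
        exists p : Z -> G s, non_expansive p /\ surjective p) :
  (exists (A : compactBiMetricGroupType R) (a : forall s : Sigma, A -> G s),
      is_inverse_limit alpha a)
  /\
  (forall beta : bonding_maps G,
      is_inverse_system beta ->
      (forall (s t : Sigma) (st : (s <= t)%O), surjective (beta s t st)) ->
      forall (A : compactBiMetricGroupType R) (a : forall s : Sigma, A -> G s)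
             (B : compactBiMetricGroupType R) (b : forall s : Sigma, B -> G s),
        is_inverse_limit alpha a -> is_inverse_limit beta b ->
        isometrically_isomorphic A B)
  /\
  (forall (A : compactBiMetricGroupType R) (a : forall s : Sigma, A -> G s),
      is_inverse_limit alpha a -> forall s : Sigma, surjective (a s)).
Proof.
have [D bound] := uniform_mdist_bound Z_compact Z_onto.
have cL : compact [set: thread alpha_sys bound].
  exact: thread_compact dirSigma Z_compact Z_onto.
split.
  exists (compact_thread cL), (thread_proj alpha_sys bound).
  exact: compact_thread_inverse_limit.
split; last first.
  move=> A a la.
  by have [] := inverse_limit_regular dirSigma alpha_sys alpha_surj Z_compact
    Z_onto la.
move=> beta beta_sys beta_surj A a B b la lb.
have [S0|Sempty] := pselect ([set: Sigma] !=set0); last first.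
  (* Over an empty index set the two systems are equal. *)
  have E : beta = alpha.
    apply/functional_extensionality_dep => s.
    by case: Sempty; exists s.
  rewrite E in lb.
  have [f [g [[fM fne] [_ gne] fK gK _]]] := inverse_limit_unique la lb.
  exists f; split=> //; first by exists g.
  exact: non_expansive_cancel_isometry fne gne fK.
have [aiso asurj] := inverse_limit_regular dirSigma alpha_sys alpha_surj
  Z_compact Z_onto la.
have [biso bsurj] := inverse_limit_regular dirSigma beta_sys beta_surj
  Z_compact Z_onto lb.
exact: isometric_of_cones dirSigma S0 alpha_sys beta_sys la.1 aiso asurj
  lb.1 biso bsurj.
Qed.
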